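(* Let $\mathcal{A}=\{A_1,\ldots,A_m\}$ be a finite set of real $n\times n$ matrices. For a scalar $\gamma>0$, let $\mathcal{A}_\gamma=\{\gamma A_1,\ldots,\gamma A_m\}$. Let $G(N,E)$ be a path-complete graph whose edges are labeled with words from $\mathcal{A}_\gamma^*$. If there exist positive definite, continuous, and homogeneous functions $V_i:\mathbb{R}^n\to\mathbb{R}$, one per node $i\in N$ of the graph, such that $\{V_i \mid i\in N\}$ is a graph Lyapunov function associated with $G(N,E)$, then $\rho(\mathcal{A})\le \frac{1}{\gamma}$.
   Context: The joint spectral radius of $\mathcal{A}=\{A_1,\ldots,A_m\}$ is $\rho(\mathcal{A})=\lim_{k\to\infty}\max_{\sigma\in\{1,\ldots,m\}^k}\|A_{\sigma_k}\cdots A_{\sigma_2}A_{\sigma_1}\|^{1/k}$ (independent of the norm). Words and graphs. A finite set of $m$ matrices is regarded as an alphabet with $m$ letters. A word of length $k\ge 1$ is a formal sequence $A_{i_k}\cdots A_{i_1}$ of letters, read from right to left, and is also identified with the corresponding matrix product; $\mathcal{A}^*$ is the set of all finite words. All graphs are finite directed graphs $G(N,E)$ with node set $N\neq\emptyset$ and edges labeled by words; self-loops, and several edges with different labels between the same ordered pair of nodes, are allowed. Expanded graph. The expanded graph $G^e(N^e,E^e)$ of $G(N,E)$ is obtained as follows: every edge from $i$ to $j$ whose label $A_{i_k}\cdots A_{i_1}$ has length $k>1$ is removed and replaced by a path $i\to s_1\to\cdots\to s_{k-1}\to j$ through $k-1$ newly added nodes (new for each such edge), the $k$ consecutive edges of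 the path being labeled $A_{i_1},\ldots,A_{i_k}$ in this order. Edges with labels of length one are left unchanged. Path-complete. $G(N,E)$ is path-complete if for every $k\ge1$ and every word $A_{\sigma_k}\cdots A_{\sigma_1}$ of length $k$ over the alphabet, there is a directed path (starting at any node) in the expanded graph whose consecutive edge labels are $A_{\sigma_1},\ldots,A_{\sigma_k}$. (In the claim the alphabet is $\mathcal{A}_\gamma$.) Graph Lyapunov function. A family $\{V_i\mid i\in N\}$ is a graph Lyapunov function associated with $G(N,E)$ if for every edge in $E$ going from a node $i$ to a node $j$ with label $L$, $V_j(Lx)\le V_i(x)$ for all $x\in\mathbb{R}^n$, where $L$ acts as a matrix product. Functions. Positive definite means $V(0)=0$ and $V(x)>0$ for $x\ne0$. Homogeneous means that there is a real $d>0$, common to all the functions $V_i$, with $V_i(\lambda x)=|\lambda|^dV_i(x)$ for all $\lambda\in\mathbb{R}$ and $x\in\mathbb{R}^n$. *)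

(* Defs.v *)
From HB Require Import structures.
From mathcomp Require Import all_boot all_order all_algebra.
From mathcomp Require Import all_classical all_reals all_analysis.

Set Implicit Arguments.
Unset Strict Implicit.
Unset Printing Implicit Defensive.

Import Order.TTheory GRing.Theory Num.Theory.
Import numFieldNormedType.Exports.

Local Open Scope ring_scope.

(* A word A_{i_k} ... A_{i_1} is read from right to left: it is stored in
   reading order, as the nonempty sequence [:: i_1; ...; i_k] of letters. *)
Definition word (L : Type) : Type := {w : seq L | (0 < size w)%N}.

Definition letters (L : Type) (w : word L) : seq L := sval w.

(* word_mx A [:: i_1; ...; i_k] = A i_k *m ... *m A i_1 *)
Definition word_mx (R : realType) (n : nat) (L : Type) (A : L -> 'M[R]_n)
    (w : seq L) : 'M[R]_n :=
  foldl (fun P i => A i *m P) 1%:M w.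

(* The library norm on matrices is the largest absolute value of an entry.
   The limit exists for every finite family of matrices and does not depend on
   the norm; the term of index k = 0 plays no role in it. *)
Definition jsr (R : realType) (m n : nat) (A : 'I_m -> 'M[R]_n) : R :=
  limn (fun k : nat =>
    \big[Num.max/0]_(s : k.-tuple 'I_m) (`|word_mx A s| `^ k%:R^-1)).

(* Edges form a type of their own, so that loops and several edges between the
   same ordered pair of nodes are allowed. *)
Record lgraph (L : Type) := LGraph {
  node : finType;
  edge : finType;
  src : edge -> node;
  tgt : edge -> node;
  label : edge -> L;
  node_nonempty : (0 < #|node|)%N
}.

Section Expanded.
Variables (L : Type) (G : lgraph (word L)).

Definition wlen (e : edge G) : nat := size (letters (label e)).

(* inr (existT _ e j), with j : 'I_(k-1), is the node s_{j+1} added on the path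
   that replaces the edge e, where k is the length of the label of e. *)
Definition exp_node : finType :=
  (node G + {e : edge G & 'I_(wlen e).-1})%type.

(* The edge of index j : 'I_k is the (j+1)-st edge of that path. If k = 1, its
   only edge is e itself. *)
Definition exp_edge : finType := {e : edge G & 'I_(wlen e)}.

(* The p-th node (0 <= p <= k) of the path
   src e -> s_1 -> ... -> s_{k-1} -> tgt e. *)
Definition exp_pos (e : edge G) (p : nat) : exp_node :=
  if p == 0%N then inl (src e)
  else if insub p.-1 is Some j
       then inr (existT (fun e => 'I_(wlen e).-1) e j)
       else inl (tgt e).

Definition exp_src (f : exp_edge) : exp_node := exp_pos (tag f) (tagged f).

Definition exp_tgt (f : exp_edge) : exp_node := exp_pos (tag f) (tagged f).+1.

Definition exp_label (f : exp_edge) : L :=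
  tnth (in_tuple (letters (label (tag f)))) (tagged f).

Lemma exp_node_nonempty : (0 < #|exp_node|)%N.
Proof. by rewrite card_sum addn_gt0 node_nonempty. Qed.

Definition expanded : lgraph L :=
  LGraph exp_src exp_tgt exp_label exp_node_nonempty.

End Expanded.

Definition is_walk (L : Type) (G : lgraph L) (p : seq (edge G)) : bool :=
  sorted (fun e f => tgt e == src f) p.

Definition path_complete (L : Type) (G : lgraph (word L)) : Prop :=
  forall w : word L, exists p : seq (edge (expanded G)),
    is_walk p /\ [seq label f | f <- p] = letters w.

Definition graph_lyapunov (R : realType) (n : nat) (L : Type)
    (A : L -> 'M[R]_n) (G : lgraph (word L))
    (V : node G -> 'cV[R]_n -> R) : Prop :=
  forall (e : edge G) (x : 'cV[R]_n),
    V (tgt e) (word_mx A (letters (label e)) *m x) <= V (src e) x.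

Definition posdef (R : realType) (n : nat) (f : 'cV[R]_n -> R) : Prop :=
  f 0 = 0 /\ forall x : 'cV[R]_n, x != 0 -> 0 < f x.

Definition homogeneous (R : realType) (n : nat) (d : R)
    (f : 'cV[R]_n -> R) : Prop :=
  forall (l : R) (x : 'cV[R]_n), f (l *: x) = `|l| `^ d * f x.

(* Main.v *)
Require Import Defs.
From mathcomp Require Import all_boot all_order all_algebra.
From mathcomp Require Import all_classical all_reals all_analysis.
From mathcomp Require Import zify.
Import Order.TTheory GRing.Theory Num.Theory.
Import numFieldNormedType.Exports.
Local Open Scope ring_scope.

Set Implicit Arguments.
Unset Strict Implicit.
Unset Printing Implicit Defensive.

(** A Lyapunov function all of whose members are comparable to the norm forces
    every product along a walk to be bounded. If in addition every word over
    the scaled alphabet is read along a walk, then all products of the matrices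
    gamma A_i are bounded by one constant C, so a product of k of the A_i has
    norm at most C / gamma^k; its k-th root is at most C^(1/k) / gamma, which
    tends to 1 / gamma.

    Two points make this work here.

    The functions V_i are homogeneous of some degree d. Replacing V_i by its
    d-th root keeps the Lyapunov inequalities and makes the degree 1; a
    continuous positive function attains a positive minimum and a maximum on
    the compact unit sphere, so by homogeneity the roots lie between two
    positive multiples of the norm ([homogeneous_root_norm_equivalent]).

    The walks promised by path-completeness live in the expanded graph, and may
    start and end in the middle of a replaced edge. The Lyapunov function is
    therefore extended to the added nodes. At the p-th node of the path that
    replaces an edge, the value at x of the V of the target after the letters
    still to be read does not increase along the path, but it vanishes wherever
    the remaining product does. Taking the maximum with a q^p |x| repairs this:
    if q |B x| <= |x| for all letters B, this term does not increase either, and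
    a small enough a keeps it below the V_i at both ends of the path. The result
    is a Lyapunov function for the expanded graph, where all labels have length
    one ([expanded_lyapunov_decr]), and no partial edge has to be treated apart
    ([word_mx_bounded]). *)

(** * The entrywise maximum norm *)

Section MatrixNorm.
Variable R : realType.

Lemma mx_norm_leP p q (M : 'M[R]_(p, q)) (c : R) : 0 <= c ->
  reflect (forall i j, `|M i j| <= c) (`|M| <= c).
Proof.
move=> c0; rewrite [`|M|]/Num.norm /= mx_normrE.
apply: (iffP (bigmax_leP _ _ _ _)) => [[_ Mc] i j | Mc].
  exact: (Mc (i, j)).
by split=> // -[i j] _ /=.
Qed.

Lemma norm_trmx p q (M : 'M[R]_(p, q)) : `|M^T| = `|M|.
Proof.
suff le r s (N : 'M[R]_(r, s)) : `|N^T| <= `|N|.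
  by apply/le_anti; rewrite le /= -{1}[M]trmxK le.
apply/mx_norm_leP => // i j; rewrite mxE.
exact: (mx_norm_leP N (normr_ge0 N) (lexx _)).
Qed.

Lemma trmx_continuous p q : continuous (@trmx R p q).
Proof.
move=> M A /(@nbhs_normP R 'M[R]_(q, p))[e /= e0 eA].
apply/(@nbhs_normP R 'M[R]_(p, q)).
by exists e => // N /= MN; apply: eA; rewrite /= -linearB /= norm_trmx.
Qed.

Lemma norm_mulmx_le p q r (M : 'M[R]_(p, q)) (N : 'M[R]_(q, r)) :
  `|M *m N| <= q%:R * `|M| * `|N|.
Proof.
apply/mx_norm_leP => [|i j]; first by rewrite !mulr_ge0.
rewrite mxE (le_trans (ler_norm_sum _ _ _)) //.
have -> : q%:R * `|M| * `|N| = \sum_(k < q) `|M| * `|N|.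
  by rewrite sumr_const card_ord -mulrA mulr_natl.
apply: ler_sum => k _; rewrite normrM ler_pM //.
  exact: (mx_norm_leP M (normr_ge0 M) (lexx _)).
exact: (mx_norm_leP N (normr_ge0 N) (lexx _)).
Qed.

(** The columns of M are its values on the basis vectors, which have norm 1.
    This turns bounds along trajectories into bounds on products. *)
Lemma mx_norm_le_op p q (M : 'M[R]_(p, q)) (c : R) : 0 <= c ->
  (forall x : 'cV[R]_q, `|M *m x| <= c * `|x|) -> `|M| <= c.
Proof.
move=> c0 Mc; apply/mx_norm_leP => // i j.
have d1 : `|delta_mx j 0 : 'cV[R]_q| <= 1.
  apply/mx_norm_leP => // k l.
  by rewrite mxE; case: (_ && _); rewrite ?normr1 ?normr0.
have -> : M i j = (M *m delta_mx j 0 : 'cV_p) i 0 by rewrite -colE mxE.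
have : `|M *m delta_mx j 0 : 'cV_p| <= c.
  by rewrite (le_trans (Mc _)) // ler_piMr.
by move/(mx_norm_leP _ c0); apply.
Qed.

End MatrixNorm.

(** * Homogeneous functions and the norm *)

Section NormEquivalence.
Variables (R : realType) (n : nat).

Definition norm_equivalent (f : 'cV[R]_n -> R) (a b : R) : Prop :=
  [/\ 0 < a, 0 < b & forall x, a * `|x| <= f x <= b * `|x|].

(** Over a finite index set the constants can be chosen uniformly, as a minimum
    and a maximum; finiteness of the graphs is used here. *)
Lemma norm_equivalent_family (I : finType) (W : I -> 'cV[R]_n -> R) :
  (forall i, exists a b, norm_equivalent (W i) a b) ->
  exists a b, forall i, norm_equivalent (W i) a b.
Proof.
move=> /boolp.choice[a /boolp.choice[b ab]].
exists (\big[Num.min/1]_i a i), (\big[Num.max/1]_i b i) => i.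
have [_ _ Wi] := ab i; split.
- by apply/bigmin_gtP; split=> // j _; have [] := ab j.
- exact: lt_le_trans ltr01 (bigmax_ge_id _ _ _ _).
- move=> x; have /andP[lo up] := Wi x; apply/andP; split.
    by apply: le_trans lo; rewrite ler_wpM2r // bigmin_le.
  by apply: le_trans up _; rewrite ler_wpM2r // le_bigmax.
Qed.

(** By homogeneity it is enough to bound f on the unit sphere, where it attains
    its extrema by compactness. *)
Lemma homogeneous_root_norm_equivalent (f : 'cV[R]_n -> R) (d : R) :
  0 < d -> posdef f -> continuous f -> homogeneous d f ->
  exists a b, norm_equivalent (fun x => f x `^ d^-1) a b.
Proof.
move=> d0 [f0 fpos] fc fh.
have fge0 x : 0 <= f x by have [->|/fpos/ltW//] := eqVneq x 0; rewrite f0.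
have rootZ l x : f (l *: x) `^ d^-1 = `|l| * f x `^ d^-1.
  rewrite fh powRM ?powR_ge0 // -powRrM mulfV ?lt0r_neq0 // powRr1 //.
have root0 : f 0 `^ d^-1 = 0 by rewrite f0 powR0 // invr_eq0 lt0r_neq0.
(* The sphere of row vectors is the one [bounded_closed_compact] applies to, so
   f is composed with the transpose. *)
pose S : set 'rV[R]_n := [set u | `|u| = 1]%classic.
have unit x : x != 0 -> S (`|x|^-1 *: x)^T.
  move=> x0; rewrite /S /= norm_trmx normrZ normfV normr_id mulVf //.
  by rewrite normr_eq0.
(* The sphere is empty exactly in dimension 0. *)
have [[u0 Su0]|Sempty] := pselect (S !=set0)%classic; last first.
  have x0 (x : 'cV[R]_n) : x = 0.
    by apply/eqP/negPn/negP => /unit Sx; apply: Sempty; exists (`|x|^-1 *: x)^T.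
  exists 1, 1; split=> // x; rewrite (x0 x) normr0 root0 mulr0 lexx //.
have Scompact : compact S.
  apply: bounded_closed_compact.
    by exists 1; split=> // y y1 u /= ->; exact: ltW.
  have -> : S = (Num.norm @^-1` [set 1 : R])%classic by [].
  apply: preimage_closed; last exact: closed_eq.
  by move=> u _; exact: norm_continuous.
have ftc : {within S, continuous (f \o trmx)}%classic.
  apply: continuous_subspaceT => u; apply: continuous_comp; last exact: fc.
  exact: trmx_continuous.
have S0 : (S !=set0)%classic by exists u0.
have [umin /set_mem Sumin lo] := compact_EVT_min S0 Scompact ftc.
have [umax /set_mem Sumax up] := compact_EVT_max S0 Scompact ftc.
have Spos u : S u -> 0 < f u^T.
  move=> Su; apply: fpos; apply/eqP => /(congr1 Num.norm).
  by rewrite norm_trmx normr0 Su; apply/eqP; rewrite oner_eq0.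
exists (f umin^T `^ d^-1), (f umax^T `^ d^-1).
split; [exact/powR_gt0/Spos|exact/powR_gt0/Spos|move=> x].
have [->|x0] := eqVneq x 0; first by rewrite root0 normr0 !mulr0 lexx.
have -> : f x `^ d^-1 = f (`|x|^-1 *: x)  `^ d^-1 * `|x|.
  by rewrite rootZ normfV normr_id mulrAC mulVf ?mul1r // normr_eq0.
have /mem_set Sx := unit x x0.
have d'0 : 0 <= d^-1 by rewrite invr_ge0 ltW.
rewrite !ler_wpM2r //= ge0_ler_powR ?nnegrE //.
  by have := up _ Sx; rewrite /= trmxK.
by have := lo _ Sx; rewrite /= trmxK.
Qed.

End NormEquivalence.

(** * Lyapunov functions along walks *)

Section Words.
Variables (R : realType) (n : nat) (L : Type).

Lemma word_mx_cons (B : L -> 'M[R]_n) i w :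
  word_mx B (i :: w) = word_mx B w *m B i.
Proof.
rewrite /word_mx /= mulmx1 -[X in foldl _ X _]mul1mx.
elim: w (1%:M : 'M[R]_n) => [//|j w IHw] P /=.
by rewrite mulmxA IHw.
Qed.

Lemma word_mx_scale (B : L -> 'M[R]_n) (g : R) w :
  word_mx (fun i => g *: B i) w = g ^+ size w *: word_mx B w.
Proof.
elim: w => [|i w IHw]; first by rewrite scale1r.
by rewrite !word_mx_cons IHw -scalemxAl -scalemxAr scalerA exprSr.
Qed.

Lemma walk_lyapunov (B : L -> 'M[R]_n) (H : lgraph L)
    (W : node H -> 'cV[R]_n -> R) :
  (forall (f : edge H) x, W (tgt f) (B (label f) *m x) <= W (src f) x) ->
  forall (f : edge H) (p : seq (edge H)) x, is_walk (f :: p) ->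
  W (tgt (last f p)) (word_mx B [seq label e | e <- f :: p] *m x)
    <= W (src f) x.
Proof.
move=> Wdecr f p; elim: p f => [|g p IHp] f x.
  by move=> _; rewrite word_mx_cons mul1mx.
move=> /andP[/eqP fg walkp]; rewrite map_cons word_mx_cons -mulmxA.
by apply: le_trans (IHp g _ walkp) _; rewrite -fg.
Qed.

(** A word is read along some walk, and W does not increase along it. Comparing
    W with the norm at both ends of the walk bounds the product. *)
Lemma word_mx_bounded (B : L -> 'M[R]_n) (G : lgraph (word L))
    (W : exp_node G -> 'cV[R]_n -> R) (a b : R) :
  path_complete G ->
  (forall f x, W (exp_tgt f) (B (exp_label f) *m x) <= W (exp_src f) x) ->
  (forall v, norm_equivalent (W v) a b) ->
  forall w : seq L, (0 < size w)%N -> `|word_mx B w| <= b / a.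
Proof.
move=> complete Wdecr Wnorm w w0.
have [p [walkp]] := complete (exist _ w w0); rewrite /letters /= => labels.
case: p walkp labels => [_ w_nil|f p walkp labels].
  by rewrite -w_nil in w0.
have [a0 b0 _] := Wnorm (exp_src f).
apply: mx_norm_le_op => [|x]; first by rewrite divr_ge0 // ltW.
rewrite mulrAC ler_pdivlMr // mulrC.
have [_ _ /(_ x) /andP[_ up]] := Wnorm (exp_src f).
apply: le_trans up.
have := @walk_lyapunov B (expanded G) W Wdecr f p x walkp.
rewrite labels; apply: le_trans.
by have [_ _ /(_ (word_mx B w *m x)) /andP[]] := Wnorm (exp_tgt (last f p)).
Qed.

End Words.

(** * Extension of a Lyapunov function to the expanded graph *)

Section ExpandedLyapunov.
Variables (R : realType) (n : nat) (L : Type) (B : L -> 'M[R]_n).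
Variables (G : lgraph (word L)) (V : node G -> 'cV[R]_n -> R).
Variables (a q : R).

(** On the added nodes, the first term of the maximum carries the Lyapunov
    inequality and the second makes the function comparable to the norm even
    if the remaining product is singular. *)
Definition expanded_lyapunov (v : exp_node G) (x : 'cV[R]_n) : R :=
  match v with
  | inl i => V i x
  | inr (existT e j) =>
      Num.max (V (tgt e) (word_mx B (drop j.+1 (letters (label e))) *m x))
              (a * q ^+ j.+1 * `|x|)
  end.

Lemma exp_pos_last (e : edge G) : exp_pos e (wlen e) = inl (tgt e).
Proof.
rewrite /exp_pos; have /lt0n_neq0/negPf-> : (0 < wlen e)%N := svalP (label e).
by case: insubP => // j; rewrite ltnn.
Qed.

Lemma exp_pos_inner (e : edge G) p (ltp : (p < (wlen e).-1)%N) :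
  exp_pos e p.+1 = inr (existT (fun e => 'I_(wlen e).-1) e (Ordinal ltp)).
Proof. by rewrite /exp_pos /= insubT. Qed.

Hypotheses (a0 : 0 < a) (q0 : 0 < q) (q1 : q <= 1).
Hypothesis aV : forall i x, a * `|x| <= V i x.
Hypothesis qB : forall l (x : 'cV[R]_n), q * `|B l *m x| <= `|x|.
Hypothesis lyapV : graph_lyapunov B V.

(** The formula of the added nodes is a lower bound at both ends of the path as
    well: at the source by the Lyapunov inequality of the whole edge, at the
    target because no letter remains, and a q^p |x| stays below every V_i since
    q <= 1. With the next lemma, all the steps of a path are treated alike,
    including the single step of an edge with a label of length one. *)
Lemma expanded_lyapunov_ge (e : edge G) p x : (p <= wlen e)%N ->
  Num.max (V (tgt e) (word_mx B (drop p (letters (label e))) *m x))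
          (a * q ^+ p * `|x|) <= expanded_lyapunov (exp_pos e p) x.
Proof.
have aq k i y : a * q ^+ k * `|y| <= V i y.
  apply: le_trans (aV i y); rewrite ler_wpM2r // ler_piMr ?exprn_ile1 // ltW //.
case: p => [_|p ltp]; first by rewrite ge_max drop0 lyapV aq.
have [ltp'|] := ltnP p (wlen e).-1; first by rewrite exp_pos_inner.
move=> lep; have -> : p.+1 = wlen e by lia.
by rewrite exp_pos_last drop_size /= mul1mx ge_max lexx aq.
Qed.

Lemma expanded_lyapunov_le (e : edge G) p x : (p < wlen e)%N ->
  expanded_lyapunov (exp_pos e p.+1) x <=
  Num.max (V (tgt e) (word_mx B (drop p.+1 (letters (label e))) *m x))
          (a * q ^+ p.+1 * `|x|).
Proof.
move=> ltp; have [ltp'|lep] := ltnP p (wlen e).-1.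
  by rewrite exp_pos_inner.
have -> : p.+1 = wlen e by lia.
by rewrite exp_pos_last drop_size /= mul1mx le_max lexx.
Qed.

(** Neither of the two terms increases: reading a letter moves it from the
    remaining word to the vector, and the additional factor q makes up for the
    growth of the norm. *)
Lemma expanded_lyapunov_decr (f : exp_edge G) x :
  expanded_lyapunov (exp_tgt f) (B (exp_label f) *m x) <=
  expanded_lyapunov (exp_src f) x.
Proof.
case: f => e j; have ltj := ltn_ord j.
apply: le_trans (expanded_lyapunov_le _ ltj) _.
apply: le_trans (expanded_lyapunov_ge _ (ltnW ltj)).
set l := exp_label _.
have nthl : nth l (letters (label e)) j = l by rewrite [RHS](tnth_nth l).
rewrite [in leRHS](drop_nth l ltj) nthl word_mx_cons mulmxA.
rewrite ge_max !le_max lexx /=; apply/orP; right.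
rewrite exprSr -!mulrA ler_pM2l // ler_pM2l ?exprn_gt0 //.
Qed.

End ExpandedLyapunov.

Lemma expanded_lyapunov_norm_equivalent (R : realType) (n : nat) (L : Type)
    (B : L -> 'M[R]_n) (G : lgraph (word L)) (V : node G -> 'cV[R]_n -> R)
    (a b q : R) : 0 < q ->
  (forall i, norm_equivalent (V i) a b) ->
  forall v, exists a' b', norm_equivalent (expanded_lyapunov B V a q v) a' b'.
Proof.
move=> q0 Vab [i|[e j]]; first by exists a, b; exact: Vab.
have [a0 b0 Vtgt] := Vab (tgt e).
have aq0 : 0 < a * q ^+ j.+1 by rewrite mulr_gt0 ?exprn_gt0.
pose M := word_mx B (drop j.+1 (letters (label e))).
exists (a * q ^+ j.+1), (Num.max (b * (n%:R * `|M|)) (a * q ^+ j.+1)).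
split=> [||x]; rewrite ?lt_max ?aq0 ?orbT //.
rewrite /= -/M le_max lexx orbT /= ge_max !maxr_pMl // !le_max lexx orbT andbT.
have /andP[_ up] := Vtgt (M *m x); rewrite (le_trans up) //.
by rewrite -!mulrA ler_pM2l // mulrA norm_mulmx_le.
Qed.

(** Provides the ratio q used in [expanded_lyapunov]. *)
Lemma finite_family_contracted (R : realType) (n : nat) (L : finType)
    (B : L -> 'M[R]_n) :
  exists q : R, [/\ 0 < q, q <= 1 &
    forall l (x : 'cV[R]_n), q * `|B l *m x| <= `|x|].
Proof.
pose K := \big[Num.max/1]_(l : L) (n%:R * `|B l|).
have K1 : 1 <= K by exact: bigmax_ge_id.
have K0 : 0 < K := lt_le_trans ltr01 K1.
exists K^-1; split=> [||l x]; rewrite ?invr_gt0 ?invf_le1 //.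
rewrite mulrC ler_pdivrMr // mulrC (le_trans (norm_mulmx_le _ _)) //.
by rewrite ler_wpM2r // le_bigmax.
Qed.

(** * From bounded products to the joint spectral radius *)

Lemma cvg_powR_invn (R : realType) (C : R) : 0 < C ->
  (C `^ k%:R^-1 @[k --> \oo] --> (1 : R))%classic.
Proof.
move=> C0.
have inv0 : ((k%:R : R)^-1 @[k --> \oo] --> (0 : R))%classic.
  by rewrite -cvg_shiftS; exact: cvg_harmonic.
have -> : (fun k : nat => C `^ k%:R^-1) = (fun k => expR (k%:R^-1 * ln C)).
  by apply/funext => k; rewrite /powR gt_eqF.
have : (expR (k%:R^-1 * ln C) @[k --> \oo] --> expR (0 * ln C))%classic.
  by apply: continuous_cvg; [exact: continuous_expR|exact: cvgMr_tmp].
by rewrite mul0r expR0.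
Qed.

Lemma jsr_le (R : realType) (m n : nat) (A : 'I_m -> 'M[R]_n) (gamma C : R) :
  0 < gamma -> 0 < C ->
  (forall w : seq 'I_m, (0 < size w)%N ->
     `|word_mx (fun i => gamma *: A i) w| <= C) ->
  jsr A <= 1 / gamma.
Proof.
move=> g0 C0 wC; rewrite /jsr.
set u := fun k : nat => _.
(* If u diverges, [limn u] is the default value 0, which satisfies the bound. *)
have [cvu|/dvgP ->] := pselect (cvgn u); last by rewrite divr_ge0 // ltW.
have cvC : (C `^ k%:R^-1 / gamma @[k --> \oo] --> 1 / gamma)%classic.
  by apply: cvgMr_tmp; exact: cvg_powR_invn.
rewrite -(cvg_lim _ cvC) //; apply: ler_lim => //; first exact: cvgP cvC.
near=> k; have k0 : (0 < k)%N by near: k; exact: nbhs_infty_gt.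
apply: bigmax_le => [|s _]; first by rewrite divr_ge0 ?powR_ge0 // ltW.
rewrite ler_pdivlMr //.
have g_ge0 := ltW g0.
have -> : gamma = (gamma ^+ k) `^ k%:R^-1.
  by rewrite -powR_mulrn // -powRrM mulfV ?pnatr_eq0 -?lt0n // powRr1.
rewrite -powRM ?exprn_ge0 // ge0_ler_powR ?invr_ge0 ?nnegrE //.
- by rewrite mulr_ge0 ?exprn_ge0.
- exact: ltW.
have := wC s; rewrite word_mx_scale size_tuple normrZ mulrC => /(_ k0).
by rewrite ger0_norm ?exprn_ge0.
Unshelve. all: by end_near. Qed.

Theorem theorem2p4 (R : realType) (m n : nat) (A : 'I_m -> 'M[R]_n)
    (gamma : R) (G : lgraph (word 'I_m)) :
  0 < gamma ->
  path_complete G ->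
  (exists V : node G -> 'cV[R]_n -> R,
    [/\ forall i, posdef (V i),
        forall i, continuous (V i),
        exists2 d : R, 0 < d & forall i, homogeneous d (V i)
      & graph_lyapunov (fun i => gamma *: A i) V]) ->
  jsr A <= 1 / gamma.
Proof.
move=> gamma0 complete [V [Vpos Vcont [d d0 Vhom] Vlyap]].
pose U i x := V i x `^ d^-1.
have Vge0 i x : 0 <= V i x.
  by have [V0 Vgt0] := Vpos i; have [->|/Vgt0/ltW//] := eqVneq x 0; rewrite V0.
have Ulyap : graph_lyapunov (fun i => gamma *: A i) U.
  move=> e x; rewrite ge0_ler_powR ?nnegrE ?Vge0 ?Vlyap //.
  by rewrite invr_ge0 ltW.
have [a [b Uab]] : exists a b, forall i, norm_equivalent (U i) a b.
  apply: norm_equivalent_family => i.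
  exact: homogeneous_root_norm_equivalent.
have [q [q0 q1 qA]] := finite_family_contracted (fun i => gamma *: A i).
have [i0 _] := card_gt0P (node_nonempty G).
have [a0 _ _] := Uab i0.
have aU i x : a * `|x| <= U i x by have [_ _ /(_ x)/andP[]] := Uab i.
have [a' [b' Wab]] := norm_equivalent_family
  (expanded_lyapunov_norm_equivalent (fun i => gamma *: A i) q0 Uab).
have [a'0 b'0 _] := Wab (inl i0).
apply: (@jsr_le _ _ _ _ _ (b' / a')) => //; first exact: divr_gt0.
apply: word_mx_bounded complete _ Wab => f x.
exact: expanded_lyapunov_decr.
Qed.
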